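(* There exists an absolute constant $C_0>0$ such that, for every Parry number $\beta$, the number $s$ of distinct cyclotomic irreducible factors of the Parry polynomial $n_\beta^*(X)$ satisfies $s\leq C_0\sqrt{d_P}$, where $d_P=\deg n_\beta^*$.
   Context: For non-integer $\beta>1$, $d_\beta(1)=0.t_1t_2\ldots$ with $t_1=\lfloor\beta\rfloor$, $t_{j+1}=\lfloor\beta T_\beta^j(1)\rfloor$, $T_\beta(x)=\beta x-\lfloor\beta x\rfloor$; $\beta$ is a Parry number if $(t_i)$ is eventually periodic. Parry polynomial: if $t_i=0$ for $i>m$, $t_m\neq0$: $n_\beta^*(X)=X^m-\sum_{i=1}^mt_iX^{m-i}$; otherwise with minimal preperiod $m\ge0$ and period $p+1$: if $m\ge1$, $n_\beta^*(X)=X^{m+p+1}-\sum_{i=1}^{m+p+1}t_iX^{m+p+1-i}-X^m+\sum_{i=1}^mt_iX^{m-i}$; if $m=0$, $n_\beta^*(X)=X^{p+1}-\sum_{i=1}^pt_iX^{p+1-i}-(1+t_{p+1})$. *)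

(* Defs.v *)
From HB Require Import structures.
From mathcomp Require Import all_boot all_order all_algebra all_field.
From mathcomp Require Import finmap.
From mathcomp Require Import boolp classical_sets functions cardinality reals.

Set Implicit Arguments.
Unset Strict Implicit.
Unset Printing Implicit Defensive.

Import Order.TTheory GRing.Theory Num.Theory.
Local Open Scope classical_set_scope.
Local Open Scope ring_scope.

Definition beta_transf (R : realType) (beta x : R) : R :=
  beta * x - (Num.floor (beta * x))%:~R.

(* [renyi_digit beta i] is t_i, with indices starting at 1; the value at 0 is
   irrelevant. *)
Definition renyi_digit (R : realType) (beta : R) (i : nat) : int :=
  Num.floor (beta * iter i.-1 (beta_transf beta) 1).

Definition renyi_periodic (R : realType) (beta : R) (m q : nat) : Prop :=
  (0 < q)%N /\
  forall i : nat, (m < i)%N -> renyi_digit beta (i + q) = renyi_digit beta i.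

Definition parry_number (R : realType) (beta : R) : Prop :=
  [/\ 1 < beta, beta \isn't a Num.int & exists m q, renyi_periodic beta m q].

Definition renyi_finite (R : realType) (beta : R) (m : nat) : Prop :=
  [/\ (0 < m)%N, renyi_digit beta m <> 0 &
      forall i : nat, (m < i)%N -> renyi_digit beta i = 0].

Definition renyi_minimal_periodic (R : realType) (beta : R) (m q : nat) : Prop :=
  renyi_periodic beta m q /\
  forall m' q', renyi_periodic beta m' q' -> (m <= m')%N /\ (q <= q')%N.

Definition is_parry_poly (R : realType) (beta : R) (P : {poly int}) : Prop :=
  let t := renyi_digit beta in
  (exists2 m, renyi_finite beta m &
     P = 'X^m - \sum_(1 <= i < m.+1) t i *: 'X^(m - i))
  \/
  ((forall m, ~ renyi_finite beta m) /\
   exists m p, renyi_minimal_periodic beta m p.+1 /\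
     P = if (0 < m)%N then
           'X^(m + p + 1)
           - \sum_(1 <= i < (m + p + 1).+1) t i *: 'X^(m + p + 1 - i)
           - 'X^m + \sum_(1 <= i < m.+1) t i *: 'X^(m - i)
         else
           'X^(p + 1) - \sum_(1 <= i < p.+1) t i *: 'X^(p + 1 - i)
           - (1 + t p.+1)%:P).

(* 'Phi_n is monic, so [%|] on {poly int} is divisibility in Z[X] here. *)
Definition cyclotomic_factors (P : {poly int}) : set {poly int} :=
  [set F | exists2 n : nat, (0 < n)%N & F = 'Phi_n /\ F %| P].

(* [fset_set] sends infinite sets to the empty one; [finite_cyclotomic_factors]
   and [is_parry_poly_neq0] below exclude this case for Parry polynomials. *)
Definition num_cyclotomic_factors (P : {poly int}) : nat :=
  #|` fset_set (cyclotomic_factors P)|.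

Lemma finite_cyclotomic_factors (P : {poly int}) :
  P != 0 -> finite_set (cyclotomic_factors P).
Proof.
move=> P0; set f : {poly int} -> {poly algC} := map_poly intr.
have fP0 : f P != 0 by rewrite map_poly_eq0_id0 // intr_eq0 lead_coef_eq0.
have [rs frs] := closed_field_poly_normal (f P).
pose ord (z : algC) := xget 0%N [set n : nat | n.-primitive_root z].
apply: (@sub_finite_set _ _ ((Cyclotomic \o ord) @` [set` rs])); last first.
  by apply: finite_image; exact: finite_seq.
move=> F [n n0 [FE FP]]; have [z zn] := C_prim_root_exists n0.
have fFz : root (f F) z.
  by rewrite FE /f (Cintr_Cyclotomic zn) root_cyclotomic.
have fPz : root (f P) z.
  have Fm : F \is monic by rewrite FE Cyclotomic_monic.
  have /(Pdiv.IdomainMonic.dvdpP Fm)[q ->] := FP.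
  by rewrite /f rmorphM rootM; apply/orP; right.
exists z.
  move: fPz; rewrite frs rootZ ?lead_coef_eq0 // root_prod_XsubC => zrs.
  exact: zrs.
rewrite /= FE; congr ('Phi__); rewrite /ord; case: xgetP => [m _ /= zm|/(_ n)//].
by apply/eqP; rewrite eqn_dvd (prim_order_dvd zn) (prim_order_dvd zm) !prim_expr_order ?eqxx.
Qed.

Lemma is_parry_poly_neq0 (R : realType) (beta : R) (P : {poly int}) :
  is_parry_poly beta P -> P != 0.
Proof.
have top (a : nat -> int) n k l : (0 < l)%N -> (n <= l)%N ->
    (\sum_(1 <= i < k) a i *: 'X^(n - i))`_l = 0.
  move=> l0 nl; rewrite coef_sum big_nat big1 // => i /andP[i0 _].
  rewrite coefZ coefXn gtn_eqF ?mulr0 //.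
  by case: n nl => [|n] nl //; apply: leq_trans nl; rewrite ltn_subrL i0.
case=> [[m [m0 _ _] ->]|[_ [m [p [_ ->]]]]].
  apply/eqP => /(congr1 (fun Q : {poly int} => Q`_m)) /eqP.
  by rewrite coefB top // coefXn eqxx coef0 subr0 oner_eq0.
case: ifP => m0.
  apply/eqP => /(congr1 (fun Q : {poly int} => Q`_(m + p + 1))) /eqP.
  have l0 : (0 < m + p + 1)%N by rewrite addn1.
  have ml : (m < m + p + 1)%N by rewrite addn1 ltnS leq_addr.
  rewrite coefD !coefB !top // ?(ltnW ml) // !coefXn eqxx coef0 gtn_eqF //.
apply/eqP => /(congr1 (fun Q : {poly int} => Q`_(p + 1))) /eqP.
rewrite !coefB top ?addn1 // coefXn eqxx coef0 coefC /= !subr0.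
by rewrite oner_eq0.
Qed.

Lemma renyi_periodicMn (R : realType) (beta : R) (m q k i : nat) :
  renyi_periodic beta m q -> (m < i)%N ->
  renyi_digit beta (i + k * q) = renyi_digit beta i.
Proof.
move=> [_ per] mi; elim: k => [|k IHk]; first by rewrite mul0n addn0.
by rewrite mulSnr addnA per // (leq_trans mi) ?leq_addr.
Qed.

Lemma renyi_minimal_periodic_ex (R : realType) (beta : R) :
  (exists m q, renyi_periodic beta m q) ->
  exists m p, renyi_minimal_periodic beta m p.+1.
Proof.
move=> [m0 [q0 per0]].
have exm : exists m, `[< exists q, renyi_periodic beta m q >].
  by exists m0; apply/asboolP; exists q0.
have exq : exists q, `[< exists m, renyi_periodic beta m q >].
  by exists q0; apply/asboolP; exists m0.
case: (ex_minnP exm) => m /asboolP[q mq] mmin.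
case: (ex_minnP exq) => r /asboolP[m' mr] rmin.
have [r0 per'] := mr; exists m, r.-1; rewrite prednK //; split; last first.
  by move=> a b ab; split; [apply: mmin|apply: rmin]; apply/asboolP;
    [exists b|exists a].
have [q_gt0 _] := mq; split=> // i mi.
have mir : (m < i + r)%N by rewrite ltn_addr.
have m'i : (m' < i + m' * q)%N.
  rewrite -[m' in (m' < _)%N]add0n -addSn leq_add ?leq_pmulr //.
  exact: leq_ltn_trans mi.
by rewrite -(renyi_periodicMn m' mq mi) -(renyi_periodicMn m' mq mir) addnAC per'.
Qed.

Lemma is_parry_poly_ex (R : realType) (beta : R) :
  parry_number beta -> exists P, is_parry_poly beta P.
Proof.
case=> _ _ /renyi_minimal_periodic_ex[m [p mp]].
have [[k fin]|nfin] := pselect (exists k, renyi_finite beta k).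
  by eexists; left; exists k.
eexists; right; split; last by exists m, p; split; [exact: mp|reflexivity].
by move=> k fin; apply: nfin; exists k.
Qed.

Lemma is_parry_poly_uniq (R : realType) (beta : R) (P Q : {poly int}) :
  is_parry_poly beta P -> is_parry_poly beta Q -> P = Q.
Proof.
case=> [[m fin ->]|[nfin [m [p [[per min] ->]]]]];
  case=> [[m' fin' ->]|[nfin' [m' [p' [[per' min'] ->]]]]].
- suff -> : m = m' by [].
  have [_ t t0] := fin; have [_ t' t0'] := fin'.
  by case: (ltngtP m m') => // [/t0|/t0'].
- by case: (nfin' m).
- by case: (nfin m').
have [mm' pp'] := min _ _ per'; have [m'm p'p] := min' _ _ per.
have -> : m' = m by apply/eqP; rewrite eqn_leq m'm.
by have /eqP -> : p' == p by rewrite eqn_leq -ltnS p'p -ltnS.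
Qed.

(* Main.v *)
(* The polynomials 'Phi_n are pairwise coprime of degree phi(n), so distinct
   cyclotomic factors 'Phi_n of P, n in S, give sum_(n in S) phi(n) <= deg P.
   It remains to see that #|S|^2 = O(sum_(n in S) phi(n)) for every finite set
   S of positive integers, which follows from
   sum_(n >= m) 1 / phi(n)^2 <= 72 / m.
   For the latter, phi(n) / n * prod_(p | n) (1 + 1/p) is
   prod_(p | n) (1 - 1/p^2) >= 1/2, hence n / phi(n) <= 2 sum_(d | n) 1/d;
   by Cauchy-Schwarz and the convergence of sum d^(-3/2) the square of the
   right-hand side is at most 12 sum_(d | n) d^(-1/2). Divide by n^2 and
   exchange the sums over n and d. *)
Require Import Defs.
From mathcomp Require Import all_boot all_order all_algebra all_field.
From mathcomp Require Import finmap boolp classical_sets cardinality.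
From mathcomp Require Import reals ring lra zify.

Import Order.TTheory GRing.Theory Num.Theory.
Local Open Scope ring_scope.

(** * Comparison of sums and products over lists *)

Lemma sum_le_telescope (F : numDomainType) (u f : nat -> F) (m n : nat) :
  (m <= n)%N -> (forall k, (m <= k < n)%N -> u k <= f k - f k.+1) ->
  \sum_(m <= k < n) u k <= f m - f n.
Proof.
move=> mn uf; rewrite -opprB -telescope_sumr // -sumrN.
by apply: ler_sum_nat => k /uf; rewrite opprB.
Qed.

Lemma ler_sum_uniq_subset (F : numDomainType) (T : eqType) (s t : seq T)
    (u : T -> F) :
  uniq s -> uniq t -> {subset s <= t} -> {in t, forall x, 0 <= u x} ->
  \sum_(x <- s) u x <= \sum_(x <- t) u x.
Proof.
move=> us ut st u0; rewrite [X in _ <= X](bigID (mem s)) /= -[X in _ <= X + _]big_filter.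
rewrite (perm_big [seq x <- t | x \in s]).
  rewrite lerDl big_seq_cond.
  by apply: sumr_ge0 => x /andP[/u0].
apply: uniq_perm; rewrite ?filter_uniq // => x; rewrite mem_filter.
by case xs: (x \in s) => //=; rewrite st.
Qed.

Lemma ler_prod_uniq_subset (F : numDomainType) (T : eqType) (s t : seq T)
    (u : T -> F) :
  uniq s -> uniq t -> {subset s <= t} -> {in t, forall x, 0 <= u x <= 1} ->
  \prod_(x <- t) u x <= \prod_(x <- s) u x.
Proof.
move=> us ut st u01; rewrite [X in X <= _](bigID (mem s)) /= -[X in X * _ <= _]big_filter.
rewrite (perm_big s).
  rewrite ler_piMr //.
    by rewrite big_seq prodr_ge0 // => x /st /u01 /andP[].
  by rewrite big_seq_cond prodr_ile1 // => x /andP[/u01].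
apply: uniq_perm; rewrite ?filter_uniq // => x; rewrite mem_filter.
by case xs: (x \in s) => //=; rewrite st.
Qed.

(** * The totient function and sums of inverse divisors *)

(** Each factor is [(k - 1)(k + 1) / k^2], so the product telescopes. *)
Lemma prod_one_sub_inv_sqr (F : realFieldType) (n : nat) :
  \prod_(2 <= k < n.+2) (1 - (k%:R ^+ 2)^-1 : F) = n.+2%:R / (2 * n.+1%:R).
Proof.
elim: n => [|n IHn]; first by rewrite big_nil; lra.
rewrite big_nat_recr //= IHn -!natr1.
by have := ler0n F n => n0; field; rewrite !lt0r_neq0 //; lra.
Qed.

(** All factors lie in [[0, 1]], so enlarging [s] to a full interval starting at 2 only decreases
    the product, and the closed form there exceeds 1/2. *)
Lemma prod_one_sub_inv_sqr_ge_half (F : realFieldType) (s : seq nat) :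
  uniq s -> {in s, forall k, (1 < k)%N} ->
  2^-1 <= \prod_(k <- s) (1 - (k%:R ^+ 2)^-1 : F).
Proof.
move=> us s1; set n := \max_(k <- s) k.
apply: (@le_trans _ _ (\prod_(2 <= k < n.+2) (1 - (k%:R ^+ 2)^-1))).
  rewrite prod_one_sub_inv_sqr -[n.+2%:R]natr1 -[n.+1%:R]natr1.
  by have n0 := ler0n F n; rewrite ler_pdivlMr; lra.
apply: ler_prod_uniq_subset => // [|k ks|k]; first exact: iota_uniq.
  by rewrite mem_index_iota s1 //= ltnS ltnW // ltnS /n leq_bigmax_seq.
rewrite mem_index_iota => /andP[k2 _].
have k1 : (1 : F) <= k%:R by rewrite ler1n ltnW.
have k0 : (0 : F) < k%:R ^+ 2 by rewrite exprn_gt0 // (lt_le_trans ltr01).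
have ki : 0 <= (k%:R ^+ 2)^-1 :> F by rewrite invr_ge0 ltW.
have : (k%:R ^+ 2)^-1 <= 1 :> F by rewrite invf_le1 // expr_ge1 // ler0n.
by rewrite subr_ge0 gerBl => ->.
Qed.

Lemma totient_prod (F : numFieldType) (n : nat) : (0 < n)%N ->
  (totient n)%:R = n%:R * \prod_(p <- primes n) (1 - p%:R^-1) :> F.
Proof.
move=> n0.
have nE : n%:R = \prod_(p <- primes n) (p ^ logn p n)%:R :> F.
  by rewrite {1}(prod_prime_decomp n0) prime_decompE big_map natr_prod.
rewrite nE totientE // natr_prod -big_split /= big_seq [RHS]big_seq.
apply: eq_bigr => p pn.
have pp : prime p by move: pn; rewrite mem_primes => /and3P[].
have : (0 < logn p n)%N by rewrite logn_gt0.
case: (logn p n) => // k _; rewrite /= natrM !natrX exprS.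
have p0 : p%:R != 0 :> F by rewrite pnatr_eq0 -lt0n prime_gt0.
rewrite -subn1 natrB ?prime_gt0 //; field; exact: p0.
Qed.

(** Expand the product one prime at a time: when [p] does not divide [m], the divisors [d] of [m]
    and the products [p d] are distinct divisors of [p m]. *)
Lemma prod_one_add_inv_le_sum_divisors (F : realFieldType) (s : seq nat) :
  uniq s -> all prime s ->
  \prod_(p <- s) (1 + p%:R^-1 : F) <=
  \sum_(d <- divisors (\prod_(p <- s) p)) d%:R^-1.
Proof.
elim: s => [|p s IHs] /=.
  by move=> _ _; rewrite !big_nil (_ : divisors 1 = [:: 1%N]) // big_seq1 invr1.
move=> /andP[ps us] /andP[pp prs]; rewrite !big_cons.
have p0 := prime_gt0 pp.
set m := (\prod_(j <- s) j)%N.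
have m0 : (0 < m)%N.
  by rewrite /m big_seq prodn_cond_gt0 // => i /(allP prs)/prime_gt0.
have pm : ~~ (p %| m)%N.
  apply: contra ps; rewrite /m; elim: (s) prs => [|q r IHr] /=.
    by rewrite big_nil Euclid_dvd1.
  move=> /andP[qq rr]; rewrite big_cons Euclid_dvdM // inE.
  by rewrite dvdn_prime2 // => /orP[->//|/(IHr rr) ->]; rewrite orbT.
apply: (@le_trans _ _ ((1 + p%:R^-1) * \sum_(d <- divisors m) d%:R^-1)).
  by rewrite ler_wpM2l ?IHs // addr_ge0 ?ler01 // invr_ge0 ler0n.
rewrite mulrDl mul1r mulr_sumr.
under [X in _ + X]eq_bigr do rewrite -invfM -natrM.
rewrite -(big_map (muln p) xpredT (fun d => d%:R^-1)) -big_cat.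
apply: ler_sum_uniq_subset => [||d|d _]; last by rewrite invr_ge0 ler0n.
- rewrite cat_uniq divisors_uniq map_inj_uniq ?divisors_uniq /= ?andbT.
    apply/hasPn => _ /mapP[d dm ->] /=; rewrite -dvdn_divisors //.
    by apply: contra pm; apply: dvdn_trans; rewrite dvdn_mulr.
  by move=> a b /eqP; rewrite eqn_pmul2l // => /eqP.
- exact: divisors_uniq.
- rewrite mem_cat -!dvdn_divisors ?muln_gt0 ?p0 // => /orP[dm|].
    by rewrite dvdn_mull.
  by case/mapP => e; rewrite -dvdn_divisors // => em ->; rewrite dvdn_pmul2l.
Qed.

Lemma le_totient_sum_divisors (F : realFieldType) (n : nat) : (0 < n)%N ->
  n%:R <= 2 * (totient n)%:R * \sum_(d <- divisors n) d%:R^-1 :> F.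
Proof.
move=> n0; have prn : all prime (primes n).
  by apply/allP => p; rewrite mem_primes => /and3P[].
have p1 p : p \in primes n -> (1 < p)%N by move=> /(allP prn)/prime_gt1.
(* The radical of [n] divides [n], so its divisors are among those of [n]. *)
have radn : (\prod_(p <- primes n) p %| n)%N.
  rewrite [X in (_ %| X)%N](prod_prime_decomp n0) prime_decompE big_map.
  rewrite big_seq [X in (_ %| X)%N]big_seq.
  apply: (big_ind2 (fun a b => a %| b)%N) => // [a b c d|p]; first exact: dvdn_mul.
  by rewrite -logn_gt0 => l0; rewrite /= dvdn_exp.
have le_prod : \prod_(p <- primes n) (1 + p%:R^-1) <=
    \sum_(d <- divisors n) d%:R^-1 :> F.
  apply: le_trans
    (prod_one_add_inv_le_sum_divisors F (primes n) (primes_uniq n) prn) _.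
  apply: ler_sum_uniq_subset; rewrite ?divisors_uniq //; last first.
    by move=> d _; rewrite invr_ge0 ler0n.
  by move=> d; rewrite -!dvdn_divisors ?(dvdn_gt0 n0) // => /dvdn_trans; apply.
apply: le_trans (ler_wpM2l _ le_prod); last by rewrite mulr_ge0 ?ler0n.
rewrite totient_prod // -!mulrA -big_split /=.
under eq_bigr do rewrite -subr_sqr expr1n exprVn.
have := prod_one_sub_inv_sqr_ge_half F (primes n) (primes_uniq n) p1.
have : 0 < n%:R :> F by rewrite ltr0n.
set x : F := \prod_(i <- _) _; nra.
Qed.

(** * Tails of the sum of [1 / phi(n)^2] *)

(* [(n.-1 %/ l).+1] is the ceiling of [n / l]: it increases by one exactly
   when [n] passes a multiple of [l], and the sum telescopes. *)
Lemma sum_inv_sqr_multiples (F : realFieldType) (l m n : nat) :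
  (0 < l)%N -> (0 < m)%N ->
  \sum_(m <= k < n | (l %| k)%N) (k%:R ^+ 2)^-1 <= 2 / (l%:R * m%:R) :> F.
Proof.
move=> l0 m0; have lF : 0 < l%:R :> F by rewrite ltr0n.
have mF : 0 < m%:R :> F by rewrite ltr0n.
case: (leqP m n) => [mn|/ltnW nm]; last first.
  by rewrite big_geq // divr_ge0 // mulr_ge0 // ltW.
(* At [k = q l] the drop of [f] is [2 / (l^2 q (q + 1))], which the numerator 2 makes at least
   [1 / (q l)^2] since [q >= 1]; at other [k] it is 0. *)
pose f k : F := 2 / (l%:R ^+ 2 * (k.-1 %/ l).+1%:R).
have f0 k : 0 <= f k by rewrite /f divr_ge0 // mulr_ge0 ?ler0n // exprn_ge0 // ltW.
have fm : f m <= 2 / (l%:R * m%:R).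
  rewrite /f ler_pM2l // lef_pV2 ?posrE ?mulr_gt0 ?exprn_gt0 ?ltr0n //.
  rewrite expr2 -mulrA ler_pM2l // -natrM ler_nat mulnC.
  by rewrite -[X in (X <= _)%N](prednK m0) ltn_ceil.
apply: le_trans fm; apply: (@le_trans _ _ (f m - f n)); last by rewrite gerBl.
rewrite big_mkcond /=; apply: sum_le_telescope => // k /andP[mk _].
have k0 : (0 < k)%N by exact: leq_trans mk.
have kE : (k %/ l = (l %| k) + k.-1 %/ l)%N.
  by have := divnS k.-1 l0; rewrite prednK.
rewrite /f /= kE; case: ifP => lk; last by rewrite add0n subrr.
rewrite add1n; case/dvdnP: lk => q kq; have q0 : (0 < q)%N by case: q kq k0 => [->|].
have -> : (k.-1 %/ l).+1 = q.
  by move: kE; rewrite kq mulnK // dvdn_mull // add1n => ->.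
rewrite kq natrM -[q.+1%:R]natr1; have q1 : 1 <= q%:R :> F by rewrite ler1n.
rewrite -subr_ge0.
have -> : 2 / (l%:R ^+ 2 * q%:R) - 2 / (l%:R ^+ 2 * (q%:R + 1)) -
    ((q%:R * l%:R) ^+ 2)^-1
  = (q%:R - 1) / (l%:R ^+ 2 * q%:R ^+ 2 * (q%:R + 1)) :> F.
  by field; rewrite !lt0r_neq0 //; lra.
by rewrite divr_ge0 ?subr_ge0 // !mulr_ge0 ?exprn_ge0 //; lra.
Qed.

(** For [k >= 2], [k^(-3/2)] is at most its integral over [[k - 1, k]], that is
    [2 / sqrt (k - 1) - 2 / sqrt k]. The term [k = 1], where this would divide by 0, is split off,
    giving [1 + 2]. *)
Lemma sum_inv_sqrt3 (F : rcfType) (n : nat) :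
  \sum_(1 <= k < n) (Num.sqrt k%:R ^+ 3)^-1 <= 3 :> F.
Proof.
case: n => [|[|n]]; [by rewrite big_geq..|].
rewrite big_ltn // sqrtr1 expr1n invr1.
pose f k : F := 2 / Num.sqrt k.-1%:R.
suff : \sum_(2 <= k < n.+2) (Num.sqrt k%:R ^+ 3)^-1 <= f 2 - f n.+2.
  have : 0 <= f n.+2 by rewrite divr_ge0 // sqrtr_ge0.
  by rewrite {2}/f /= sqrtr1 divr1; lra.
apply: sum_le_telescope => // -[|[|k]] // _; rewrite /f /=.
set a := Num.sqrt k.+1%:R; set b := Num.sqrt k.+2%:R.
have a0 : 0 < a by rewrite sqrtr_gt0 ltr0n.
have b0 : 0 < b by rewrite sqrtr_gt0 ltr0n.
have ab : b ^+ 2 = a ^+ 2 + 1 by rewrite !sqr_sqrtr ?ler0n // natr1.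
have le_ab : a <= b by rewrite ler_sqrt ?ltr0n // ler_nat.
have -> : 2 / a - 2 / b = 2 / (a * b * (a + b)).
  have -> : 2 / a - 2 / b = 2 * ((b ^+ 2 - a ^+ 2)) / (a * b * (a + b)).
    by field; rewrite !lt0r_neq0 // addr_gt0.
  by rewrite ab addrAC subrr add0r mulr1.
rewrite -[X in X <= _]mul1r ler_pdivrMr ?exprn_gt0 // mulrAC.
rewrite ler_pdivlMr ?mulr_gt0 ?addr_gt0 //.
rewrite mul1r; have : a * b <= b * b by rewrite ler_pM2r.
by move=> ?; nra.
Qed.

(** Cauchy-Schwarz for [d^(-3/4)] and [d^(-1/4)]. Doubling and symmetrising the double sums avoids
    fourth roots: with [a = sqrt d] and [b = sqrt e], the terms differ by
    [(a - b)^2 / (a^3 b^3)]. *)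
Lemma sqr_sum_inv_le (F : rcfType) (s : seq nat) : {in s, forall d, (0 < d)%N} ->
  (\sum_(d <- s) d%:R^-1) ^+ 2 <=
  (\sum_(d <- s) (Num.sqrt d%:R ^+ 3)^-1) *
  (\sum_(d <- s) (Num.sqrt d%:R)^-1) :> F.
Proof.
move=> s0; rewrite -(ler_pM2l (ltr0Sn F 1)).
rewrite [X in _ <= X]mulr_natl mulr2n [X in _ <= _ + X]mulrC expr2.
rewrite !big_distrlr /= mulr_sumr -big_split /= big_seq [X in _ <= X]big_seq.
apply: ler_sum => d ds; rewrite mulr_sumr -big_split /= big_seq [X in _ <= X]big_seq.
apply: ler_sum => e es.
have [dE eE] : d%:R = Num.sqrt d%:R ^+ 2 :> F /\ e%:R = Num.sqrt e%:R ^+ 2 :> F.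
  by rewrite !sqr_sqrtr ?ler0n.
rewrite [in X in X <= _]dE [in X in X <= _]eE.
have : 0 < Num.sqrt d%:R :> F by rewrite sqrtr_gt0 ltr0n s0.
have : 0 < Num.sqrt e%:R :> F by rewrite sqrtr_gt0 ltr0n s0.
set a := Num.sqrt d%:R; set b := Num.sqrt e%:R => b0 a0.
rewrite -subr_ge0.
have -> : (a ^+ 3)^-1 * b^-1 + a^-1 * (b ^+ 3)^-1
    - 2 * ((a ^+ 2)^-1 * (b ^+ 2)^-1) = (a - b) ^+ 2 / (a ^+ 3 * b ^+ 3) by field; rewrite !lt0r_neq0.
by rewrite divr_ge0 ?sqr_ge0 // mulr_ge0 // exprn_ge0 // ltW.
Qed.

(** This gives divisor sums a range independent of [n], so that they can be exchanged with a sum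
    over [n]. *)
Lemma sum_divisors (V : nmodType) (u : nat -> V) (n N : nat) :
  (0 < n < N)%N ->
  \sum_(d <- divisors n) u d = \sum_(1 <= d < N | (d %| n)%N) u d.
Proof.
move=> /andP[n0 nN]; rewrite -[RHS]big_filter; apply: perm_big.
apply: uniq_perm; rewrite ?divisors_uniq ?filter_uniq ?iota_uniq // => d.
rewrite mem_filter mem_index_iota -dvdn_divisors //.
case dn: (d %| n)%N => //=.
by rewrite (dvdn_gt0 n0 dn) (leq_ltn_trans (dvdn_leq n0 dn) nN).
Qed.

(** The constant is [2^2 * 3]: the 2 of [le_totient_sum_divisors] squared, times the bound of
    [sum_inv_sqrt3]. *)
Lemma inv_sqr_totient_le (F : rcfType) (n : nat) : (0 < n)%N ->
  ((totient n)%:R ^+ 2)^-1 <=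
  12 * ((n%:R ^+ 2)^-1 * \sum_(d <- divisors n) (Num.sqrt d%:R)^-1) :> F.
Proof.
move=> n0; have nF : 0 < n%:R :> F by rewrite ltr0n.
have tF : 0 < (totient n)%:R :> F by rewrite ltr0n totient_gt0.
have d0 : {in divisors n, forall d, (0 < d)%N}.
  by move=> d; rewrite -dvdn_divisors // => /(dvdn_gt0 n0).
have s3 : \sum_(d <- divisors n) (Num.sqrt d%:R ^+ 3)^-1 <= 3 :> F.
  apply: le_trans (sum_inv_sqrt3 F n.+1).
  apply: ler_sum_uniq_subset; rewrite ?divisors_uniq ?iota_uniq //.
    move=> d; rewrite -dvdn_divisors // mem_index_iota => dn.
    by rewrite (dvdn_gt0 n0 dn) ltnS dvdn_leq.
  by move=> d _; rewrite invr_ge0 exprn_ge0 // sqrtr_ge0.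
have := le_totient_sum_divisors F n n0.
have := sqr_sum_inv_le F (divisors n) d0.
move: s3; set A := \sum_(d <- _) (_ ^+ 3)^-1.
set B := \sum_(d <- _) (Num.sqrt _)^-1.
set S := \sum_(d <- _) _^-1 => A3 SAB nS.
have B0 : 0 <= B by apply: sumr_ge0 => d _; rewrite invr_ge0 sqrtr_ge0.
have S2 : S ^+ 2 <= 3 * B by apply: le_trans SAB _; rewrite ler_wpM2r.
have n2 : n%:R ^+ 2 <= (2 * (totient n)%:R * S) ^+ 2.
  by rewrite lerXn2r ?nnegrE ?ler0n // (le_trans _ nS) ?ler0n.
rewrite mulrA [12 * _]mulrC -mulrA mulrC ler_pdivlMr ?exprn_gt0 // mulrC.
rewrite ler_pdivrMr ?exprn_gt0 //; apply: le_trans n2 _.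
rewrite exprMn exprMn; have := ler_wpM2l (exprn_ge0 2 (ltW tF)) S2; lra.
Qed.

Lemma sum_inv_sqr_totient (F : rcfType) (m n : nat) : (0 < m)%N ->
  \sum_(m <= k < n) ((totient k)%:R ^+ 2)^-1 <= 72 / m%:R :> F.
Proof.
move=> m0; have mF : 0 < m%:R :> F by rewrite ltr0n.
apply: (@le_trans _ _ (\sum_(m <= k < n) (12 * \sum_(1 <= d < n | (d %| k)%N)
    (k%:R ^+ 2)^-1 * (Num.sqrt d%:R)^-1))).
  apply: ler_sum_nat => k /andP[mk kn]; have k0 := leq_trans m0 mk.
  by rewrite -mulr_sumr -sum_divisors ?k0 // inv_sqr_totient_le.
rewrite -mulr_sumr (exchange_big_dep xpredT) //=.
(* The inner sum over multiples of [d] is at most [2 / (d m)]; the factor [d^(-1/2)] turns this into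
   [2 / m * d^(-3/2)]. Hence [72 = 12 * 2 * 3]. *)
apply: (@le_trans _ _ (12 * (2 / m%:R * \sum_(1 <= d < n)
    (Num.sqrt d%:R ^+ 3)^-1))).
  rewrite ler_pM2l // mulr_sumr; apply: ler_sum_nat => d /andP[d0 _].
  rewrite -mulr_suml.
  have dF : 0 < Num.sqrt d%:R :> F by rewrite sqrtr_gt0 ltr0n.
  rewrite -(ler_pM2r dF) mulfVK ?lt0r_neq0 //.
  apply: le_trans (sum_inv_sqr_multiples F d m n d0 m0) _.
  rewrite -[X in 2 / (X * _)]sqr_sqrtr ?ler0n // le_eqVlt; apply/orP; left.
  by apply/eqP; field; rewrite !lt0r_neq0.
have -> : 72 / m%:R = 12 * (2 / m%:R * 3) :> F by field; rewrite lt0r_neq0.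
by rewrite !ler_pM2l ?divr_gt0 // sum_inv_sqrt3.
Qed.

(** * Sums of totients over finite sets of integers *)

(* For every [x >= 0] one has [x <= phi + x^3 / phi^2]: compare [phi] with [x].
   Summing this over the [n >= m], with [m] about [size s / 2] and [x]
   proportional to [size s], gives the bound. *)
Lemma sqr_size_le_sum_totient (F : rcfType) (s : seq nat) :
  uniq s -> {in s, forall n, (0 < n)%N} ->
  (size s)%:R ^+ 2 <= 96 * \sum_(n <- s) (totient n)%:R :> F.
Proof.
move=> us s0; set k := size s; set m := k./2.+1.
(* Both [size r] and [m] will be at least [k / 2 = 12 x], so [x * size r - 72 x^3 / m] is at least
   [12 x^2 - 6 x^2 = k^2 / 96]. *)
pose x : F := k%:R / 24.
have x0 : 0 <= x by rewrite divr_ge0 ?ler0n.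
have kE : k%:R = 24 * x by rewrite /x; field.
clearbody x.
pose r := [seq n <- s | (m <= n)%N].
(* At most [k./2] positive integers lie below [m], so at least half of the distinct entries of [s]
   remain in [r]. *)
have size_r : k%:R <= 2 * (size r)%:R :> F.
  have : (size [seq n <- s | ~~ (m <= n)%N] <= k./2)%N.
    rewrite -(size_iota 1 k./2); apply: uniq_leq_size; rewrite ?filter_uniq //.
    move=> n; rewrite mem_filter mem_iota -ltnNge => /andP[nm /s0 ->].
    by rewrite add1n.
  have : (size r + size [seq n <- s | ~~ (m <= n)%N] = k)%N.
    by rewrite !size_filter; exact: count_predC.
  rewrite -natrM ler_nat; move: (size r) (size _) => a b.
  by rewrite -divn2; lia.
have le_phi n : (0 < n)%N ->
    x - x ^+ 3 * ((totient n)%:R ^+ 2)^-1 <= (totient n)%:R.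
  move=> n0; have t0 : 0 < (totient n)%:R :> F by rewrite ltr0n totient_gt0.
  set t := (totient n)%:R in t0 *.
  have [xt|tx] := leP x t.
    apply: le_trans xt; rewrite gerBl mulr_ge0 ?exprn_ge0 // invr_ge0.
    by rewrite exprn_ge0 // ltW.
  apply: le_trans (ltW t0); rewrite subr_le0 ler_pdivlMr ?exprn_gt0 //.
  by rewrite [x ^+ 3]exprS ler_wpM2l // lerXn2r ?nnegrE // ltW.
have sum_r : \sum_(n <- r) ((totient n)%:R ^+ 2)^-1 <= 72 / m%:R :> F.
  apply: le_trans (sum_inv_sqr_totient F m (\max_(n <- s) n).+1 _) => //.
  apply: ler_sum_uniq_subset; rewrite ?filter_uniq ?iota_uniq //.
    move=> n; rewrite mem_filter mem_index_iota ltnS => /andP[-> ns].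
    by rewrite leq_bigmax_seq.
  by move=> n _; rewrite invr_ge0 exprn_ge0 // ler0n.
have le_r : \sum_(n <- r) (totient n)%:R <= \sum_(n <- s) (totient n)%:R :> F.
  apply: ler_sum_uniq_subset; rewrite ?filter_uniq //.
  by move=> n; rewrite mem_filter => /andP[].
have ge_r : x * (size r)%:R - x ^+ 3 * (72 / m%:R) <=
    \sum_(n <- r) (totient n)%:R :> F.
  apply: (@le_trans _ _ (\sum_(n <- r) (x - x ^+ 3 * ((totient n)%:R ^+ 2)^-1))).
    rewrite sumrB big_const_seq count_predT iter_addr_0 mulr_natr -mulr_sumr.
    by rewrite lerD2l lerN2 ler_wpM2l // exprn_ge0.
  rewrite big_seq [X in _ <= X]big_seq; apply: ler_sum => n.
  by rewrite mem_filter => /andP[_ /s0/le_phi].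
have km : k%:R <= 2 * m%:R :> F by rewrite -natrM ler_nat /m; lia.
have mF : 0 < m%:R :> F by rewrite ltr0n.
have xm : x ^+ 3 * (72 / m%:R) <= x ^+ 2 * 6.
  rewrite mulrA ler_pdivrMr // [x ^+ 3]exprSr -(mulrA _ x) -(mulrA _ 6) ler_wpM2l ?exprn_ge0 //.
  by move: km; rewrite kE; lra.
have : x * k%:R <= x * (2 * (size r)%:R) by rewrite ler_wpM2l.
by rewrite !kE; lra.
Qed.

(** * Cyclotomic divisors and the degree *)

(** A common root would be a primitive root of unity of both orders. *)
Lemma coprimep_cyclotomic (F : closedFieldType) (m n : nat) (y z : F) :
  m.-primitive_root y -> n.-primitive_root z -> m != n ->
  coprimep (cyclotomic y m) (cyclotomic z n).
Proof.
move=> ym zn mn; apply/Pdiv.ClosedField.coprimepP => x.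
rewrite root_cyclotomic // => xm; apply: contra mn.
rewrite -/(root _ x) root_cyclotomic // => xn.
rewrite eqn_dvd (prim_order_dvd xm) (prim_order_dvd xn).
by rewrite !prim_expr_order ?eqxx.
Qed.

(** Over [algC] the polynomials ['Phi_n] become pairwise coprime, so their product, whose degree is
    the sum of the totients, divides the nonzero image of [P]. *)
Lemma sum_totient_Phi_le (P : {poly int}) (s : seq nat) :
  P != 0 -> uniq s -> {in s, forall n, (0 < n)%N /\ 'Phi_n %| P} ->
  (\sum_(n <- s) totient n <= (size P).-1)%N.
Proof.
move=> P0 us sP; set f : {poly int} -> {poly algC} := map_poly intr.
have fP0 : f P != 0 by rewrite map_poly_eq0_id0 // intr_eq0 lead_coef_eq0.
have sfP : size (f P) = size P.
  by rewrite size_map_poly_id0 // intr_eq0 lead_coef_eq0.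
have fdvd n : n \in s -> f 'Phi_n %| f P.
  move=> /sP[_ /(Pdiv.IdomainMonic.dvdpP (Cyclotomic_monic n))[q ->]].
  by rewrite /f rmorphM dvdp_mull.
have fcop m n : (0 < m)%N -> (0 < n)%N -> m != n ->
    coprimep (f 'Phi_m) (f 'Phi_n).
  move=> /C_prim_root_exists[y ym] /C_prim_root_exists[z zn].
  rewrite /f (Cintr_Cyclotomic ym) (Cintr_Cyclotomic zn).
  exact: coprimep_cyclotomic.
have prod_dvd (t : seq nat) : uniq t -> {subset t <= s} ->
    \prod_(n <- t) f 'Phi_n %| f P.
  elim: t => [|n t IHt] /=; first by rewrite big_nil dvd1p.
  move=> /andP[nt ut] ts; rewrite big_cons Gauss_dvdp.
    by rewrite fdvd ?ts ?mem_head //= IHt // => i it; rewrite ts // inE it orbT.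
  rewrite big_seq; elim/big_ind: _ => [||i it]; first exact: coprimep1.
    by move=> a b; rewrite coprimepMr => -> ->.
  have [n0 _] := sP _ (ts _ (mem_head n t)).
  have [i0 _] : (0 < i)%N /\ 'Phi_i %| P by apply/sP/ts; rewrite inE it orbT.
  by apply: fcop => //; apply: contraNneq nt => ->.
have /(dvdp_leq fP0) : \prod_(n <- s) f 'Phi_n %| f P by apply: prod_dvd.
have f_monic n : f 'Phi_n \is monic by rewrite /f monic_map // Cyclotomic_monic.
have -> : size (\prod_(n <- s) f 'Phi_n) = (\sum_(n <- s) totient n).+1.
  elim: (s) (sP) => [|n t IHt] /= tP; first by rewrite !big_nil size_poly1.
  rewrite !big_cons size_monicM //; last first.
    by rewrite monic_neq0 // monic_prod.
  rewrite IHt => [|i it]; last by apply: tP; rewrite inE it orbT.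
  have [/C_prim_root_exists[z zn] _] := tP _ (mem_head n t).
  by rewrite /f (Cintr_Cyclotomic zn) size_cyclotomic addSn addnS.
by rewrite sfP; case: (size P).
Qed.

Theorem theorem3p11 (R : realType) :
  exists C0 : R, 0 < C0 /\
    forall (beta : R) (P : {poly int}),
      parry_number beta -> is_parry_poly beta P ->
      (num_cyclotomic_factors P)%:R <= C0 * Num.sqrt ((size P).-1)%:R.
Proof.
(* After squaring, any [C0] with [C0^2 >= 96] suffices. *)
exists 10; split=> // beta P _ /is_parry_poly_neq0 P0.
rewrite /num_cyclotomic_factors.
have finP := finite_cyclotomic_factors P0.
set A := fset_set _.
(* [ord] chooses an index for each factor, with default 0 outside [A]. It is injective on [A]
   because the index determines the factor. *)
have /choice[ord ordP] : forall F : {poly int}, exists n : nat,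
    F \in A -> [/\ (0 < n)%N, F = 'Phi_n & F %| P].
  move=> F; case FA: (F \in A); last by exists 0%N.
  move: FA; rewrite in_fset_set // => /set_mem[n n0 [FE FP]].
  by exists n.
pose s := map ord A.
have us : uniq s.
  rewrite map_inj_in_uniq ?fset_uniq // => F G /ordP[_ FE _] /ordP[_ GE _] FG.
  by rewrite FE GE FG.
have sP : {in s, forall n, (0 < n)%N /\ 'Phi_n %| P}.
  by move=> _ /mapP[F /ordP[n0 FE FP] ->]; rewrite -FE.
have s0 : {in s, forall n, (0 < n)%N} by move=> n /sP[].
have := sqr_size_le_sum_totient R s us s0; rewrite size_map -natr_sum => le_s.
have := sum_totient_Phi_le P s P0 us sP; rewrite -(ler_nat R) => le_P.
rewrite -(@ler_pXn2r _ 2) ?nnegrE ?mulr_ge0 ?sqrtr_ge0 ?ler0n //.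
by rewrite exprMn sqr_sqrtr ?ler0n //; have := ler0n R (size P).-1; lra.
Qed.
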